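(* Suppose that $R$ is a finite direct product of local rings. Then every cu-uniserial left $R$-module is uniserial, and is virtually uniserial. In particular, if $R$ is a local ring or an Artinian ring, then every cu-uniserial left $R$-module is uniserial, and is virtually uniserial.
   Context: All rings are associative with identity and all modules are unitary left modules. A ring is local if it has a unique maximal left ideal; it is Artinian if it is both left and right Artinian. For a module $K$, $\mathrm{Rad}(K)$ denotes the intersection of all maximal submodules of $K$ (equal to $K$ if there are none). A nonzero module is uniform if every nonzero submodule is essential. A left $R$-module $M$ is cyclic-uniform uniserial (cu-uniserial) if for every finitely generated submodule $0\neq K\subseteq M$, $K/\mathrm{Rad}(K)$ is cyclic and uniform. A module $M$ is virtually simple if $M\neq 0$ and $N\cong M$ for every nonzero submodule $N$ of $M$. A module $M$ is virtually uniserial if for every finitely generated submodule $0\neq K\subseteq M$, $K/\mathrm{Rad}(K)$ is virtually simple. A module is uniserial if its submodules are linearly ordered by inclusion. *)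

(* Defs.v *)
From HB Require Import structures.
From mathcomp Require Import all_boot all_algebra generic_quotient ring_quotient.
From mathcomp Require Import boolp.
Set Implicit Arguments.
Unset Strict Implicit.
Unset Printing Implicit Defensive.
Import GRing.Theory.
Local Open Scope ring_scope.
Local Open Scope quotient_scope.

(* Rings are [pzRingType]s, so that the zero ring is allowed; left modules are
   [lmodType]s.  Submodules are boolean predicates [N : submodClosed M]; since
   excluded middle is available in [boolp], every subset of [M] closed under
   the module operations is of this form.  Equality of submodules is [=i]. *)

Section Submodule.
Variables (R : pzRingType) (M : lmodType R) (N : submodClosed M).

Definition submod : Type := {x : M | x \in N}.

HB.instance Definition _ := SubChoice.on submod.
HB.instance Definition _ := [SubChoice_isSubLmodule of submod by <:].

End Submodule.

Section QuotientModule.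
Variables (R : pzRingType) (M : lmodType R) (N : submodClosed M).

Definition submod_pred : {pred M} := fun x => x \in N.

Lemma submod_zmod_closed : zmod_closed submod_pred.
Proof.
have [N0 NL] := submodClosedP N; split=> [//|x y Nx Ny].
by rewrite -[x - y]addrC -scaleN1r; exact: NL.
Qed.

HB.instance Definition _ :=
  GRing.isZmodClosed.Build M submod_pred submod_zmod_closed.

Definition quotmod : Type := Quotient.quot (submod_pred : zmodClosed M).

HB.instance Definition _ := Choice.on quotmod.
HB.instance Definition _ := GRing.Zmodule.on quotmod.
HB.instance Definition _ := Quotient.on quotmod.

Definition quotmod_scale (a : R) (x : quotmod) : quotmod :=
  \pi_quotmod (a *: repr x).

Lemma quotmod_eqP (x y : M) :
  reflect (\pi_quotmod x = \pi_quotmod y) (x - y \in N).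
Proof.
have -> : (x - y \in N) = (x == y %[mod quotmod]).
  exact: (Quotient.idealrBE (submod_pred : zmodClosed M)).
exact: eqP.
Qed.

Lemma pi_quotmodD (x y : M) :
  \pi_quotmod (x + y) = \pi_quotmod x + \pi_quotmod y.
Proof. exact: Quotient.pi_add. Qed.

Lemma pi_quotmodZ (a : R) (x : M) :
  \pi_quotmod (a *: x) = quotmod_scale a (\pi_quotmod x).
Proof.
apply/quotmod_eqP; rewrite -scalerBr; apply: rpredZ.
by apply/quotmod_eqP; rewrite reprK.
Qed.

Fact quotmod_scaleA a b x :
  quotmod_scale a (quotmod_scale b x) = quotmod_scale (a * b) x.
Proof. by rewrite -[x]reprK -[quotmod_scale b _]pi_quotmodZ -2!pi_quotmodZ scalerA. Qed.

Fact quotmod_scale1 : left_id 1 quotmod_scale.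
Proof. by move=> x; rewrite -[x]reprK -pi_quotmodZ scale1r. Qed.

Fact quotmod_scaleDr : right_distributive quotmod_scale +%R.
Proof.
move=> a x y; rewrite -[x]reprK -[y]reprK.
by rewrite -pi_quotmodD -3!pi_quotmodZ -pi_quotmodD scalerDr.
Qed.

Fact quotmod_scaleDl x : {morph quotmod_scale^~ x : a b / a + b}.
Proof.
by move=> a b; rewrite -[x]reprK -3!pi_quotmodZ -pi_quotmodD scalerDl.
Qed.

HB.instance Definition _ := GRing.Zmodule_isLmodule.Build R quotmod
  quotmod_scaleA quotmod_scale1 quotmod_scaleDr quotmod_scaleDl.

End QuotientModule.

Section Radical.
Variables (R : pzRingType) (M : lmodType R).

Definition maximal_submod (N : submodClosed M) : Prop :=
  (exists x : M, x \notin N) /\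
  forall L : submodClosed M, {subset N <= L} ->
    (forall x : M, x \in L -> x \in N) \/ (forall x : M, x \in L).

Definition rad : {pred M} :=
  fun x => `[< forall N : submodClosed M, maximal_submod N -> x \in N >].

Lemma rad_closed : submod_closed rad.
Proof.
split=> [|a x y /asboolP Rx /asboolP Ry]; apply/asboolP => N maxN.
  exact: rpred0.
by apply: rpredD; [apply: rpredZ; exact: Rx | exact: Ry].
Qed.

HB.instance Definition _ := GRing.isSubmodClosed.Build R M rad
  (GRing.submod_closed_semi rad_closed).

End Radical.

Arguments rad {R} M _.

Section ModuleNotions.
Variable R : pzRingType.
Implicit Types M : lmodType R.

Definition nonzero_mod M : Prop := exists x : M, x != 0.

Definition fg_mod M : Prop :=
  exists (n : nat) (v : 'I_n -> M),
    forall x : M, exists c : 'I_n -> R, x = \sum_(i < n) c i *: v i.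

Definition cyclic_mod M : Prop :=
  exists v : M, forall x : M, exists c : R, x = c *: v.

Definition iso_mod M M' : Prop := exists f : {linear M -> M'}, bijective f.

Definition essential M (N : submodClosed M) : Prop :=
  forall L : submodClosed M, (exists2 x : M, x \in L & x != 0) ->
    exists x : M, [/\ x \in N, x \in L & x != 0].

Definition uniform_mod M : Prop :=
  nonzero_mod M /\
  forall N : submodClosed M, nonzero_mod (submod N) -> essential N.

Definition cu_uniserial M : Prop :=
  forall K : submodClosed M, fg_mod (submod K) -> nonzero_mod (submod K) ->
    cyclic_mod (quotmod (rad (submod K))) /\
    uniform_mod (quotmod (rad (submod K))).

Definition virtually_simple M : Prop :=
  nonzero_mod M /\
  forall N : submodClosed M, nonzero_mod (submod N) -> iso_mod (submod N) M.

Definition virtually_uniserial M : Prop :=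
  forall K : submodClosed M, fg_mod (submod K) -> nonzero_mod (submod K) ->
    virtually_simple (quotmod (rad (submod K))).

Definition uniserial M : Prop :=
  forall N L : submodClosed M, {subset N <= L} \/ {subset L <= N}.

End ModuleNotions.

(* A left ideal of [R] is a submodule of the regular module [R^o]. *)
Definition local_ring (R : pzRingType) : Prop :=
  exists2 m : submodClosed R^o, maximal_submod m &
    forall m' : submodClosed R^o, maximal_submod m' -> m' =i m.

Definition left_artinian (R : pzRingType) : Prop :=
  forall I : nat -> submodClosed R^o,
    (forall n, {subset I n.+1 <= I n}) ->
    exists n, forall m, (n <= m)%N -> I m =i I n.

(* Left ideals of the converse ring [R^c] are the right ideals of [R]. *)
Definition artinian (R : pzRingType) : Prop :=
  left_artinian R /\ left_artinian R^c.

(* [R] is isomorphic to the product of the [S i]: the map to the product type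
   with components [f i] is a ring morphism for the pointwise operations
   because each [f i] is one. *)
Definition finite_product_of_local_rings (R : pzRingType) : Prop :=
  exists (n : nat) (S : 'I_n -> pzRingType) (f : forall i, {rmorphism R -> S i}),
    (forall i, local_ring (S i)) /\
    bijective (fun (x : R) (i : 'I_n) => f i x).

(* Main.v *)
From Pilot Require Import Defs.
From mathcomp Require Import all_boot all_algebra.
From HB Require Import structures.
From mathcomp Require Import generic_quotient boolp classical_sets.
(* [rad] also names the radical of a bilinear form; this restores the radical
   of a module. *)
Import Pilot.Defs.
Set Implicit Arguments.
Unset Strict Implicit.
Unset Printing Implicit Defensive.
Import GRing.Theory.
Local Open Scope ring_scope.
Local Open Scope quotient_scope.

(** The three kinds of rings share one property: finitely many maximal left
    ideals already intersect inside the Jacobson radical ([semilocal]).  For a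
    local ring a single one does; for a finite product, every maximal left
    ideal is the preimage of the maximal left ideal of one factor
    ([product_semilocal]); for a left Artinian ring, a finite intersection not
    inside the radical could be shrunk forever ([left_artinian_semilocal]).
    Artinian rings need not be products of local rings (matrix rings are not),
    so the argument goes through semilocal rings instead of reducing the
    second claim to the first.

    Over a semilocal ring a uniform module [Q] with [rad Q = 0] is simple
    ([uniform_simple]).  Indeed the Jacobson radical kills [Q], hence so does a
    finite intersection of maximal left ideals, and this forces [Q] to contain
    a simple submodule ([meet_atom]).  As [rad Q = 0], some maximal submodule
    [N] misses the simple one, and uniformity then forces [N = 0].

    For a finitely generated nonzero submodule [K] of a cu-uniserial module
    this applies to [K / rad K], whose radical is zero ([rad_quot]).  So
    [K / rad K] is simple, which gives virtual uniseriality at once, and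
    [rad K] is a maximal submodule of [K].  To compare elements [x] and [y],
    take [K = R x + R y]: one of the two, say [x], lies outside [rad K].  If
    [y] were not in [R x], Zorn's lemma would give a maximal submodule of [K]
    containing [x] but not [y]; it contains [rad K] strictly, contradicting
    maximality of [rad K].  Hence [R x] and [R y] are comparable for all [x]
    and [y], and so are any two submodules. *)

(** * Submodules given by propositions *)

Section SubmoduleOf.
Variables (R : pzRingType) (M : lmodType R).

Definition submod_prop (P : M -> Prop) : Prop :=
  P 0 /\ forall a x y, P x -> P y -> P (a *: x + y).

Definition pred_of_prop (P : M -> Prop) of submod_prop P : {pred M} :=
  fun x => `[< P x >].

Variables (P : M -> Prop) (clP : submod_prop P).

Lemma pred_of_prop_closed : submod_closed (pred_of_prop clP).
Proof.
case: (clP) => P0 PL; split=> [|a x y /asboolP Px /asboolP Py]; apply/asboolP.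
  exact: P0.
exact: PL.
Qed.

HB.instance Definition _ := GRing.isSubmodClosed.Build R M (pred_of_prop clP)
  (GRing.submod_closed_semi pred_of_prop_closed).

Definition submod_of : submodClosed M := pred_of_prop clP.

Lemma submod_ofP (x : M) : reflect (P x) (x \in submod_of).
Proof. exact: asboolP. Qed.

End SubmoduleOf.

(** * Adjoining an element, and maximality in terms of elements *)

Section Generated.
Variables (R : pzRingType) (M : lmodType R).

Fact adjoin_closed (N : submodClosed M) (x : M) :
  submod_prop (fun z => exists b : R, z - b *: x \in N).
Proof.
split=> [|a y z [b Nb] [c Nc]]; first by exists 0; rewrite scale0r subr0 rpred0.
exists (a * b + c); rewrite scalerDl -scalerA opprD addrACA -scalerBr.
by rewrite rpredD ?rpredZ.
Qed.

Definition adjoin (N : submodClosed M) (x : M) : submodClosed M := submod_of (adjoin_closed N x).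

Lemma adjoinP (N : submodClosed M) (x z : M) :
  reflect (exists b : R, z - b *: x \in N) (z \in adjoin N x).
Proof. exact: submod_ofP. Qed.

Lemma add_adjoin (N : submodClosed M) (x u : M) (b : R) :
  u \in N -> u + b *: x \in adjoin N x.
Proof. by move=> Nu; apply/adjoinP; exists b; rewrite addrK. Qed.

Lemma sub_adjoin (N : submodClosed M) (x : M) : {subset N <= adjoin N x}.
Proof. by move=> z Nz; apply/adjoinP; exists 0; rewrite scale0r subr0. Qed.

Lemma mem_adjoin (N : submodClosed M) (x : M) : x \in adjoin N x.
Proof. by apply/adjoinP; exists 1; rewrite scale1r subrr rpred0. Qed.

Fact zero_closed : submod_prop (fun x : M => x = 0).
Proof. by split=> // a x y -> ->; rewrite scaler0 addr0. Qed.

Definition zero_submod : submodClosed M := submod_of zero_closed.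

Definition principal (x : M) : submodClosed M := adjoin zero_submod x.

Lemma principalP (x z : M) : reflect (exists b : R, z = b *: x) (z \in principal x).
Proof.
apply: (iffP (adjoinP _ _ _)) => -[b zb]; exists b.
  by apply/eqP; rewrite -subr_eq0; apply/eqP/(submod_ofP zero_closed).
by rewrite zb subrr rpred0.
Qed.

(** Testing maximality only against the submodules [N + R c] turns it into a
    solvability condition on elements, which transports along morphisms without
    any comparison of lattices of submodules. *)
Lemma maximal_submodP (N : submodClosed M) :
  maximal_submod N <->
  (exists x, x \notin N) /\
  forall c d : M, c \notin N -> exists b : R, d - b *: c \in N.
Proof.
split=> -[Nproper Nmax]; split=> //.
  move=> c d Nc; have [sub|all_in] := Nmax _ (@sub_adjoin N c).
    by rewrite sub ?mem_adjoin in Nc.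
  exact/adjoinP.
move=> L NL; case: (pselect (forall x, x \in L -> x \in N)); first by left.
move/existsNP=> [c /not_implyP [Lc /negP Nc]]; right=> d.
have [b Nb] := Nmax c d Nc.
by rewrite -(subrK (b *: c) d) rpredD ?rpredZ // NL.
Qed.

Lemma in_radP (x : M) :
  reflect (forall N : submodClosed M, maximal_submod N -> x \in N) (x \in rad M).
Proof. exact: asboolP. Qed.

End Generated.

(** In [R^o] scaling is multiplication; this form avoids mixing the two types. *)
Lemma maximal_left_idealP (R : pzRingType) (m : submodClosed R^o) :
  maximal_submod m <->
  (exists x : R, (x : R^o) \notin m) /\
  forall c d : R, (c : R^o) \notin m -> exists b : R, (d - b * c : R^o) \in m.
Proof. exact: maximal_submodP. Qed.

Lemma left_idealM (R : pzRingType) (m : submodClosed R^o) (b c : R) :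
  (c : R^o) \in m -> (b * c : R^o) \in m.
Proof. exact: (@rpredZ R R^o m b c). Qed.

Lemma left_idealB (R : pzRingType) (m : submodClosed R^o) (b c d : R) :
  (c : R^o) \in m -> (d : R^o) \in m -> (d - b * c : R^o) \in m.
Proof.
suff /(_ c d) : forall x y : R^o, x \in m -> y \in m -> y - b *: x \in m by [].
by move=> x y mx my; rewrite -scaleNr rpredD ?rpredZ.
Qed.

(** * The Jacobson radical annihilates modules with zero radical *)

Section Colon.
Variables (R : pzRingType) (M : lmodType R) (N : submodClosed M) (v : M).

Fact colon_closed : @submod_prop R R^o (fun c : R => c *: v \in N).
Proof.
split=> [|a x y Nx Ny]; first by rewrite scale0r rpred0.
suff: (a * (x : R) + (y : R)) *: v \in N by [].
by rewrite scalerDl -scalerA rpredD ?(rpredZ a).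
Qed.

Definition colon : submodClosed R^o := submod_of colon_closed.

Lemma colonP (c : R) : reflect (c *: v \in N) ((c : R^o) \in colon).
Proof. exact: submod_ofP. Qed.

Lemma maximal_colon : maximal_submod N -> v \notin N -> maximal_submod colon.
Proof.
move=> /maximal_submodP [_ Nmax] Nv; apply/maximal_left_idealP; split.
  by exists 1; apply: contra Nv => /colonP; rewrite scale1r.
move=> c d /colonP/negP Nc; have [b Nb] := Nmax _ (d *: v) Nc.
by exists b; apply/colonP; rewrite scalerBl -scalerA.
Qed.

End Colon.

(** If a maximal submodule [N] misses [v] then the annihilator of [v] modulo [N]
    is a maximal left ideal, so it contains [c]. *)
Lemma jacobson_scale (R : pzRingType) (M : lmodType R) (c : R) (v : M) :
  (c : R^o) \in rad R^o -> c *: v \in rad M.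
Proof.
move=> /in_radP Jc; apply/in_radP => N maxN.
have [Nv|Nv] := boolP (v \in N); first exact: rpredZ.
exact/colonP/Jc/maximal_colon.
Qed.

(** * Semilocal rings *)

Record max_left_ideal (R : pzRingType) := MaxLeftIdeal {
  left_ideal_of : submodClosed R^o;
  left_ideal_of_max : maximal_submod left_ideal_of
}.

Definition meet (R : pzRingType) (s : seq (max_left_ideal R)) (c : R) : bool :=
  all (fun m => (c : R^o) \in left_ideal_of m) s.

(** Equivalent to [R] modulo its Jacobson radical being semisimple, in the form
    that the proofs produce and consume. *)
Definition semilocal (R : pzRingType) : Prop :=
  exists s : seq (max_left_ideal R), forall c : R, meet s c -> (c : R^o) \in rad R^o.

Lemma meetB (R : pzRingType) (s : seq (max_left_ideal R)) (b c d : R) :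
  meet s c -> meet s d -> meet s (d - b * c).
Proof.
rewrite /meet; elim: s => //= -[m maxm] s IHs /= /andP[mc sc] /andP[md sd].
by rewrite IHs // andbT; exact: left_idealB.
Qed.

Lemma meetM (R : pzRingType) (s : seq (max_left_ideal R)) (b c : R) :
  meet s c -> meet s (b * c).
Proof.
rewrite /meet; elim: s => //= -[m maxm] s IHs /= /andP[mc sc].
by rewrite IHs // andbT; exact: left_idealM.
Qed.

Fact meet_closed (R : pzRingType) (s : seq (max_left_ideal R)) :
  @submod_prop R R^o (fun c : R => meet s c).
Proof.
split=> [|a x y sx sy].
  by elim: s => //= m s IHs; apply/andP; split=> //; exact: rpred0.
by have := meetB (- a) sx sy; rewrite mulNr opprK addrC.
Qed.

Section Semilocal.
Variable R : pzRingType.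

(** * Uniform modules with zero radical are simple *)

Definition simple_mod (Q : lmodType R) : Prop :=
  nonzero_mod Q /\ forall c d : Q, c != 0 -> exists b : R, d = b *: c.

(** Take the first intersection [I] in the chain that does not kill [v] while
    [I] cut with the next [m] does: [I v] is then a quotient of the simple module
    [I / (I meet m)], so any nonzero [t = c v] with [c] in [I] generates a simple
    submodule. *)
Lemma meet_atom (Q : lmodType R) (s : seq (max_left_ideal R)) (v : Q) :
  v != 0 -> (forall c, meet s c -> c *: v = 0) ->
  exists2 t : Q, t != 0 &
    forall a : R, a *: t != 0 -> exists b : R, t = b *: (a *: t).
Proof.
move=> v0; elim: s => [|[m maxm] s IHs] kill.
  by rewrite -(scale1r v) kill ?eqxx in v0.
have [killI|/existsNP[c /not_implyP[sc /eqP cv0]]] :=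
  pselect (forall c, meet s c -> c *: v = 0); first exact: IHs.
exists (c *: v) => // a; rewrite scalerA => acv0.
(* Since [a c] is outside [m], [c = b (a c)] modulo [m]; the difference lies in
   the intersection of all of [m :: s], which kills [v]. *)
have sac : meet s (a * c) by exact: meetM.
have mac : (a * c : R^o) \notin m.
  by apply: contra acv0 => mac; apply/eqP/kill/andP.
have /maximal_left_idealP[_ /(_ _ c mac) [b mb]] := maxm.
exists b; apply/eqP; rewrite -subr_eq0 scalerA -scalerBl; apply/eqP/kill/andP.
by split=> //; exact: meetB.
Qed.

Lemma nonzero_submod (M : lmodType R) (N : submodClosed M) (x : M) :
  x \in N -> x != 0 -> nonzero_mod (submod N).
Proof. by move=> Nx x0; exists (exist _ x Nx : submod N); rewrite -val_eqE. Qed.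

Lemma uniform_simple (Q : lmodType R) : semilocal R ->
  uniform_mod Q -> (forall x : Q, x \in rad Q -> x = 0) -> simple_mod Q.
Proof.
move=> [s sJ] [[v v0] unif] rad0; split; first by exists v.
have [|t t0 atom] := @meet_atom Q s v v0.
  by move=> c sc; apply/rad0/jacobson_scale/sJ.
have [N maxN Nt] : exists2 N : submodClosed Q, maximal_submod N & t \notin N.
  apply: contrapT => noN; case/eqP: t0; apply/rad0/in_radP => N maxN.
  by apply: contrapT => /negP Nt; apply: noN; exists N.
(* A nonzero [N] would meet [R t], and then contain [t] since [R t] is simple. *)
have N0 x : x \in N -> x = 0.
  move=> Nx; apply: contrapT => /eqP x0.
  have [|z [Nz /principalP[a zE] z0]] := unif N (nonzero_submod Nx x0) (principal t).
    by exists t => //; apply/principalP; exists 1; rewrite scale1r.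
  rewrite zE in Nz z0; have [b tE] := atom a z0.
  by rewrite tE rpredZ in Nt.
move=> c d c0; have /maximal_submodP[_ Nmax] := maxN.
have [|b Nb] := Nmax c d; first by apply: contra c0 => /N0 ->.
by exists b; apply/eqP; rewrite -subr_eq0; apply/eqP/N0.
Qed.

(** * The quotient by the radical *)

Section Quotient.
Variable K : lmodType R.
Local Notation Q := (quotmod (rad K)).

Lemma piZ (a : R) (x : K) : \pi_Q (a *: x) = a *: \pi_Q x :> Q.
Proof. exact: (@pi_quotmodZ R K (rad K) a x). Qed.

Lemma piD (x y : K) : \pi_Q (x + y) = \pi_Q x + \pi_Q y :> Q.
Proof. exact: (@pi_quotmodD R K (rad K) x y). Qed.

Lemma piB (b : R) (x y : K) : \pi_Q (x - b *: y) = \pi_Q x - b *: \pi_Q y :> Q.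
Proof. by rewrite -scaleNr piD piZ scaleNr. Qed.

Lemma pi0P (x : K) : reflect (\pi_Q x = 0 :> Q) (x \in rad K).
Proof.
have := quotmod_eqP (rad K) x 0; rewrite subr0.
suff -> : \pi_Q 0 = 0 :> Q by [].
by rewrite -[X in \pi_Q X](scale0r 0) piZ scale0r.
Qed.

(** A maximal submodule of [K] contains [rad K], so its image in [K / rad K] is
    again maximal and pulls back to it. *)
Lemma rad_quot (q : Q) : q \in rad Q -> q = 0.
Proof.
rewrite -[q]reprK; move: (repr q) => x /in_radP radx; apply/pi0P/in_radP => N maxN.
have /maximal_submodP[[y Ny] Nmax] := maxN.
have radN z : z \in rad K -> z \in N by move/in_radP; exact.
have imcl : submod_prop (fun q : Q => exists2 z, z \in N & q = \pi_Q z).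
  split; first by exists 0; rewrite ?rpred0 //; apply/esym/pi0P/rpred0.
  move=> a _ _ [z1 N1 ->] [z2 N2 ->]; exists (a *: z1 + z2).
    by rewrite rpredD ?rpredZ.
  by rewrite piD piZ.
have memN z : \pi_Q z \in submod_of imcl -> z \in N.
  case/submod_ofP=> w Nw /(@quotmod_eqP R K (rad K)) /radN.
  by move=> Nzw; rewrite -(subrK w z) rpredD.
apply/memN/radx/maximal_submodP; split.
  by exists (\pi_Q y); apply: contra Ny; exact: memN.
move=> c d; rewrite -[c]reprK -[d]reprK; move: (repr c) (repr d) => {}c {}d Nc.
have [|b Nb] := Nmax c d.
  by apply: contra Nc => Nc; apply/submod_ofP; exists c.
by exists b; rewrite -piB; apply/submod_ofP; exists (d - b *: c).
Qed.

Lemma simple_quot_maximal : simple_mod Q -> maximal_submod (rad K).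
Proof.
move=> [[q q0] simQ]; apply/maximal_submodP; split.
  exists (repr q); apply: contra q0 => /pi0P.
  by rewrite reprK => ->.
move=> c d Rc; have [|b dE] := simQ (\pi_Q c) (\pi_Q d).
  by apply: contra Rc => /eqP/pi0P.
by exists b; apply/pi0P; rewrite piB dE subrr.
Qed.

End Quotient.

Lemma simple_virtually_simple (Q : lmodType R) :
  simple_mod Q -> virtually_simple Q.
Proof.
move=> [Q0 simQ]; split=> // N [x x0].
have Nall y : y \in N.
  have [|b ->] := simQ (val x) y; last exact/rpredZ/valP.
  by apply: contra x0 => /eqP x0; rewrite -val_eqE x0.
exists (val : {linear submod N -> Q}).
by exists (fun y => exist _ y (Nall y)) => [z|//]; exact: val_inj.
Qed.

(** * Comparing submodules *)

(** A submodule that contains [N] and is maximal among those avoiding [y] is a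
    maximal submodule: anything larger contains [y] and hence everything. *)
Lemma maximal_avoiding (K : lmodType R) (N : submodClosed K) (y : K) :
  y \notin N -> (forall z, z \in adjoin N y) ->
  exists2 L : submodClosed K, maximal_submod L & {subset N <= L} /\ y \notin L.
Proof.
move=> Ny gen.
(* The union of the empty chain is empty, hence no submodule; the predicate
   therefore speaks of the union of [A] and [N]. *)
pose P (A : set K) := submod_prop (fun x => A x \/ x \in N) /\ ~ A y.
have [F FP Ftot|A [[clA Ay] Amax]] := @Zorn_bigcup K P.
  split; last by case=> A /FP[_ nAy] /nAy.
  split=> [|a x z]; first by right; exact: rpred0.
  have inU (A : set K) u : F A -> A u \/ u \in N -> (\bigcup_(X in F) X)%classic u \/ u \in N.
    by move=> FA [Au|Nu]; [left; exists A | right].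
  move=> [[A FA Ax]|Nx] [[B FB Bz]|Nz].
  - have [AB|BA] := Ftot A B FA FB.
      by apply: (inU B) => //; apply: (FP _ FB).1.2; left=> //; exact: AB.
    by apply: (inU A) => //; apply: (FP _ FA).1.2; left=> //; exact: BA.
  - by apply: (inU A) => //; apply: (FP _ FA).1.2; [left|right].
  - by apply: (inU B) => //; apply: (FP _ FB).1.2; [right|left].
  - by right; rewrite rpredD ?rpredZ.
exists (submod_of clA); last first.
  split=> [z Nz|]; first by apply/submod_ofP; right.
  by apply/submod_ofP => -[//|]; apply/negP.
apply/maximal_submodP; split.
  by exists y; apply/submod_ofP => -[//|]; apply/negP.
move=> c d Lc; set L := submod_of clA in Lc *.
apply/adjoinP.
have NL : {subset N <= L} by move=> z Nz; apply/submod_ofP; right.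
have Lcy : y \in adjoin L c.
  apply: contrapT => nLcy; apply: (Amax [set` adjoin L c]%classic); last first.
    split=> //; split=> [|a x z Px Pz]; first by right; exact: rpred0.
    have inL u : [set` adjoin L c]%classic u \/ u \in N -> u \in adjoin L c.
      by case=> // /NL; exact: sub_adjoin.
    by left; rewrite /= rpredD ?rpredZ ?inL.
  rewrite properEneq; split; last first.
    by move=> z Az; apply: sub_adjoin; apply/submod_ofP; left.
  apply/eqP => AE; case/negP: Lc; apply/submod_ofP; left; rewrite AE /=.
  exact: mem_adjoin.
have /adjoinP[b Nd] := gen d.
by rewrite -(subrK (b *: y) d) rpredD ?rpredZ //; apply/sub_adjoin/NL.
Qed.

(** Otherwise a maximal submodule containing [x] but not [y] would lie strictly
    between [rad K] and [K]. *)
Lemma mem_principal_of_notin_rad (K : lmodType R) (x y : K) :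
  maximal_submod (rad K) -> (forall z, z \in adjoin (principal x) y) ->
  x \notin rad K -> y \in principal x.
Proof.
move=> maxR gen Rx; apply: contrapT => /negP xy.
have [L maxL [xL Ly]] := maximal_avoiding xy gen.
have RL : {subset rad K <= L} by move=> z /in_radP; exact.
have Lx : x \in L by apply/xL/mem_adjoin.
case: maxR => _ /(_ L RL) [sub|all_in]; first by rewrite sub in Rx.
by rewrite all_in in Ly.
Qed.

Section Span.
Variables (M : lmodType R) (x y : M).

Fact span_closed : submod_prop (fun z : M => exists a b : R, z = a *: x + b *: y).
Proof.
split=> [|c _ _ [a1 [b1 ->]] [a2 [b2 ->]]].
  by exists 0, 0; rewrite !scale0r addr0.
exists (c * a1 + a2), (c * b1 + b2).
by rewrite !scalerDl scalerDr !scalerA addrACA.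
Qed.

Definition span2 : submodClosed M := submod_of span_closed.

Lemma span2l : x \in span2.
Proof. by apply/submod_ofP; exists 1, 0; rewrite scale1r scale0r addr0. Qed.

Lemma span2r : y \in span2.
Proof. by apply/submod_ofP; exists 0, 1; rewrite scale1r scale0r add0r. Qed.

Definition gen1 : submod span2 := exist _ x span2l.
Definition gen2 : submod span2 := exist _ y span2r.

Lemma span2E (z : submod span2) : exists a b : R, z = a *: gen1 + b *: gen2.
Proof.
have /submod_ofP[a [b zE]] := valP z.
by exists a, b; apply: val_inj; rewrite [LHS]zE.
Qed.

Lemma span2_fg : fg_mod (submod span2).
Proof.
exists 2, (fun i => if i == ord0 then gen1 else gen2) => z.
have [a [b ->]] := span2E z; exists (fun i => if i == ord0 then a else b).
by rewrite big_ord_recl big_ord1.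
Qed.

End Span.

(** The maximal submodule [rad K] of [K = R x + R y] cannot contain both
    generators. *)
Lemma comparable_elements (M : lmodType R) (x y : M) :
  (x != 0 \/ y != 0 -> maximal_submod (rad (submod (span2 x y)))) ->
  y \in principal x \/ x \in principal y.
Proof.
move=> maxR; set K := submod (span2 x y) in maxR.
have [/eqP x0|x0] := boolP (x == 0).
  by right; apply/principalP; exists 0; rewrite scale0r.
have {}maxR := maxR (or_introl x0).
have valcyc (u w : K) : w \in principal u -> val w \in principal (val u).
  by move=> /principalP[b ->]; apply/principalP; exists b.
have [R1|/negP R1] := pselect (gen1 x y \in rad K); last first.
  left; apply: (valcyc (gen1 x y) (gen2 x y)); apply: mem_principal_of_notin_rad => // z.
  have [a [b ->]] := span2E z.
  by apply: add_adjoin; apply/principalP; exists a.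
have R2 : gen2 x y \notin rad K.
  case: (maxR) => -[z Rz] _; apply: contra Rz => R2.
  by have [a [b ->]] := span2E z; rewrite rpredD ?rpredZ.
right; apply: (valcyc (gen2 x y) (gen1 x y)); apply: mem_principal_of_notin_rad => // z.
have [a [b ->]] := span2E z; rewrite addrC.
by apply: add_adjoin; apply/principalP; exists b.
Qed.

Lemma uniserial_of_elements (M : lmodType R) :
  (forall x y : M, y \in principal x \/ x \in principal y) -> uniserial M.
Proof.
move=> cmp N L; have [|/existsNP[x /not_implyP[Nx /negP Lx]]] :=
  pselect {subset N <= L}; first by left.
right=> y Ly; have [/principalP[b ->]|/principalP[b xE]] := cmp x y; first exact: rpredZ.
by rewrite xE rpredZ in Lx.
Qed.

Theorem semilocal_cu_uniserial (M : lmodType R) :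
  semilocal R -> cu_uniserial M -> uniserial M /\ virtually_uniserial M.
Proof.
move=> slR cuM.
have simK (K : submodClosed M) : fg_mod (submod K) -> nonzero_mod (submod K) ->
    simple_mod (quotmod (rad (submod K))).
  by move=> fgK K0; apply: uniform_simple (@rad_quot _) => //; case: (cuM K).
split; last by move=> K fgK K0; apply/simple_virtually_simple/simK.
apply: uniserial_of_elements => x y; apply: comparable_elements => xy0.
apply/simple_quot_maximal/simK; first exact: span2_fg.
by case: xy0; apply: nonzero_submod; [exact: span2l | exact: span2r].
Qed.

End Semilocal.

(** * Local rings and left Artinian rings are semilocal *)

Lemma local_semilocal (R : pzRingType) : local_ring R -> semilocal R.
Proof.
move=> [m maxm uniq_m]; exists [:: MaxLeftIdeal maxm] => c /andP[mc _].
by apply/in_radP => N maxN; rewrite (uniq_m N maxN).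
Qed.

(** Otherwise every finite intersection of maximal left ideals has an element
    outside some further maximal left ideal; adding such ideals one by one gives
    a strictly decreasing sequence. *)
Lemma left_artinian_semilocal (R : pzRingType) : left_artinian R -> semilocal R.
Proof.
move=> dcc; apply: contrapT => /forallNP nsl.
have next (s : seq (max_left_ideal R)) : exists m : max_left_ideal R,
    exists2 c : R, meet s c & (c : R^o) \notin left_ideal_of m.
  have /existsNP[c /not_implyP[sc /negP/in_radP nJc]] := nsl s.
  have /existsNP[m /not_implyP[maxm /negP mc]] := nJc.
  by exists (MaxLeftIdeal maxm), c.
have [f fP] := choice next.
pose s := fix s n := if n is k.+1 then f (s k) :: s k else [::].
have [n stab] := dcc (fun n => submod_of (meet_closed (s n)))
  (fun n c sc => introT (submod_ofP _ _)
    (andP (elimT (submod_ofP (meet_closed (s n.+1)) c) sc)).2).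
have [c sc mc] := fP (s n).
have : (c : R^o) \in submod_of (meet_closed (s n.+1)).
  by rewrite stab //; apply/submod_ofP.
by move/submod_ofP/andP=> [mc' _]; rewrite mc' in mc.
Qed.

(** * Maximal left ideals along surjective morphisms *)

Section SurjectiveMorphism.
Variables (R T : pzRingType) (h : {rmorphism R -> T}).
Hypothesis h_surj : forall a : T, exists c : R, h c = a.

Fact preim_closed (m : submodClosed T^o) :
  @submod_prop R R^o (fun c : R => (h c : T^o) \in m).
Proof.
split=> [|a x y mx my]; first by rewrite rmorph0; exact: rpred0.
have := left_idealB (- h a) mx my.
by rewrite mulNr opprK addrC -rmorphM -rmorphD.
Qed.

Definition preim_ideal (m : submodClosed T^o) : submodClosed R^o :=
  submod_of (preim_closed m).

Lemma maximal_preim_ideal (m : submodClosed T^o) :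
  maximal_submod m -> maximal_submod (preim_ideal m).
Proof.
move=> /maximal_left_idealP[[a ma] maxm]; apply/maximal_left_idealP; split.
  have [c ca] := h_surj a.
  by exists c; apply/submod_ofP; rewrite ca; exact/negP.
move=> c d /submod_ofP/negP mc; have [a' mdc] := maxm _ (h d) mc.
have [b ba] := h_surj a'.
by exists b; apply/submod_ofP; rewrite rmorphB rmorphM ba.
Qed.

Fact image_closed (N : submodClosed R^o) :
  @submod_prop T T^o (fun a : T => exists2 c : R, (c : R^o) \in N & h c = a).
Proof.
split=> [|a _ _ [x Nx <-] [y Ny <-]]; first by exists 0; rewrite ?rmorph0 ?rpred0.
have [a' <-] := h_surj a; exists (y - (- a') * x); first exact: left_idealB.
by rewrite mulNr opprK addrC rmorphD rmorphM.
Qed.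

Definition image_ideal (N : submodClosed R^o) : submodClosed T^o :=
  submod_of (image_closed N).

Lemma maximal_image_ideal (N : submodClosed R^o) :
  maximal_submod N -> (1 : T^o) \notin image_ideal N ->
  maximal_submod (image_ideal N).
Proof.
move=> /maximal_left_idealP[_ maxN] N1; apply/maximal_left_idealP; split.
  by exists 1.
move=> a a'; have [c <-] := h_surj a; have [d <-] := h_surj a' => Nc.
have [|b Ndc] := maxN c d.
  by apply: contra Nc => Nc; apply/submod_ofP; exists c.
by exists (h b); apply/submod_ofP; exists (d - b * c); rewrite ?rmorphB ?rmorphM.
Qed.

End SurjectiveMorphism.

(** * Finite products of local rings are semilocal *)

Section Product.
Variables (R : pzRingType) (n : nat) (S : 'I_n -> pzRingType).
Variables (f : forall i, {rmorphism R -> S i}).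
Hypothesis f_bij : bijective (fun (x : R) (i : 'I_n) => f i x).

Lemma factor_embed i (a : S i) :
  exists2 c : R, f i c = a & forall j, j != i -> f j c = 0.
Proof.
have [g gK fK] := f_bij.
have fgE t j : f j (g t) = t j by rewrite -[in RHS](fK t).
exists (g (dfwith (fun j => 0 : S j) a)); first by rewrite fgE dfwith_in.
by move=> j ji; rewrite fgE dfwith_out // eq_sym.
Qed.

Lemma factor_surj i (a : S i) : exists c : R, f i c = a.
Proof. by have [c ca _] := factor_embed a; exists c. Qed.

Lemma factors_inj (x y : R) : (forall i, f i x = f i y) -> x = y.
Proof.
move=> fxy; apply: (bij_inj f_bij); exact: functional_extensionality_dep.
Qed.

(** If every image of [N] contained [1], say [f i (c i) = 1] with [c i] in [N],
    then [N] would contain [1 = \sum_i e i * c i], where the [e i] are the central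
    idempotents of the decomposition. *)
Lemma exists_proper_image (N : submodClosed R^o) : maximal_submod N ->
  exists i, (1 : (S i)^o) \notin image_ideal (@factor_surj i) N.
Proof.
move=> [[x Nx] _]; apply: contrapT => /forallNP imN.
have /choice[c cP] i : exists c : R, (c : R^o) \in N /\ f i c = 1.
  have /negP := imN i; rewrite negbK => /submod_ofP[c Nc fc].
  by exists c.
have /choice[e eP] i : exists e : R, f i e = 1 /\ forall j, j != i -> f j e = 0.
  by have [e ? ?] := factor_embed (1 : S i); exists e.
have sumE : \sum_i e i * c i = 1.
  apply: factors_inj => j; rewrite rmorph_sum rmorph1 (bigD1 j) //= big1 => [|i ij].
    by rewrite rmorphM (eP j).1 (cP j).2 mulr1 addr0.
  by rewrite rmorphM (eP i).2 ?mul0r // eq_sym.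
have N1 : (1 : R^o) \in N.
  rewrite -[X in X \in _]sumE.
  apply: (@rpred_sum R^o N) => i _; apply: left_idealM; exact: (cP i).1.
by case/negP: Nx; have := left_idealM x N1; rewrite mulr1.
Qed.

(** A maximal left ideal [N] with proper image in the factor [S i] has the
    maximal left ideal of [S i] as image.  If [c] lies over all these ideals but
    not in [N], some [1 - b * c] is in [N]; applying [f i] puts [1] in the image
    of [N]. *)
Lemma product_semilocal : (forall i, local_ring (S i)) -> semilocal R.
Proof.
move=> Sloc.
have /(_ _)/cid-/all_sig[m mP] i : exists m : max_left_ideal (S i),
    forall m' : submodClosed (S i)^o, maximal_submod m' -> m' =i left_ideal_of m.
  by have [m maxm uniq_m] := Sloc i; exists (MaxLeftIdeal maxm).
exists [seq MaxLeftIdeal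
  (maximal_preim_ideal (@factor_surj i) (left_ideal_of_max (m i))) | i <- enum 'I_n].
move=> c; rewrite /meet all_map => /allP mc; apply/in_radP => N maxN.
have [i imN1] := exists_proper_image maxN.
have imN := mP i _ (maximal_image_ideal maxN imN1).
apply: contrapT => /negP Nc.
have /maximal_left_idealP[_ /(_ c 1 Nc)[b Nbc]] := maxN.
case/negP: imN1.
have imc : (f i c : (S i)^o) \in image_ideal (@factor_surj i) N.
  by rewrite imN; have /= /submod_ofP := mc i (mem_enum _ i).
have im1 : (f i (1 - b * c) : (S i)^o) \in image_ideal (@factor_surj i) N.
  by apply/submod_ofP; exists (1 - b * c).
have := left_idealB (- f i b) imc im1.
by rewrite mulNr opprK -rmorphM -rmorphD subrK rmorph1.
Qed.

End Product.

Theorem theorem2p5 (R : pzRingType) :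
  (finite_product_of_local_rings R ->
     forall M : lmodType R, cu_uniserial M -> uniserial M /\ virtually_uniserial M) /\
  (local_ring R \/ artinian R ->
     forall M : lmodType R, cu_uniserial M -> uniserial M /\ virtually_uniserial M).
Proof.
split=> [[n [S [f [Sloc f_bij]]]] M|[locR|[artR _]] M].
- exact/semilocal_cu_uniserial/(product_semilocal f_bij).
- exact/semilocal_cu_uniserial/local_semilocal.
- exact/semilocal_cu_uniserial/left_artinian_semilocal.
Qed.
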